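(* Let $\Gamma$ be a local type environment and $\mathbb{G}$ a global type tree (balanced, well-formed and projectable onto every participant). If $\Gamma\sqsubseteq\mathbb{G}$ then $\Gamma$ is safe.
   Context: Sorts are $\mathtt{int},\mathtt{bool},\mathtt{nat}$; subsorting $\le$ is the least reflexive relation with $\mathtt{nat}\le\mathtt{int}$. Local type trees are defined coinductively by $T ::= \mathtt{end} \mid \mathtt{p}\&\{\ell_i(S_i).T_i\}_{i\in I} \mid \mathtt{p}\oplus\{\ell_i(S_i).T_i\}_{i\in I}$ with $I$ finite nonempty and the $\ell_i$ distinct. Subtyping $\le$ on local types is the largest relation such that: $\mathtt{end}\le\mathtt{end}$; $\mathtt{p}\&\{\ell_i(S_i).T_i\}_{i\in I\cup J}\le \mathtt{p}\&\{\ell_i(S'_i).T'_i\}_{i\in I}$ if for all $i\in I$, $S'_i\le S_i$ and $T_i\le T'_i$; $\mathtt{p}\oplus\{\ell_i(S_i).T_i\}_{i\in I}\le \mathtt{p}\oplus\{\ell_i(S'_i).T'_i\}_{i\in I\cup J}$ if for all $i\in I$, $S_i\le S'_i$ and $T_i\le T'_i$. Global type trees are defined coinductively by $\mathbb{G} ::= \mathtt{end} \mid \mathtt{p}\to\mathtt{q}:\{\ell_i(S_i).\mathbb{G}_i\}_{i\in I}$ ($I$ finite nonempty). $\mathrm{pt}(\mathbb{G})$ is the least solution of $\mathrm{pt}(\mathtt{end})=\emptyset$, $\mathrm{pt}(\mathtt{p}\to\mathtt{q}:\{\ell_i(S_i).\mathbb{G}_i\}_{i\in I})=\{\mathtt{p},\mathtt{q}\}\cup\bigcup_i\mathrm{pt}(\mathbb{G}_i)$.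 Projection $\upharpoonright_{\mathtt{r}}$ is the largest relation between global and local type trees such that whenever $\mathbb{G}\upharpoonright_{\mathtt{r}}T$: if $\mathtt{r}\notin\mathrm{pt}(\mathbb{G})$ then $T=\mathtt{end}$; if $\mathbb{G}=\mathtt{p}\to\mathtt{r}:\{\ell_i(S_i).\mathbb{G}_i\}_{i\in I}$ then $T=\mathtt{p}\&\{\ell_i(S_i).T_i\}_{i\in I}$ with $\mathbb{G}_i\upharpoonright_{\mathtt{r}}T_i$; if $\mathbb{G}=\mathtt{r}\to\mathtt{q}:\{\ell_i(S_i).\mathbb{G}_i\}_{i\in I}$ then $T=\mathtt{q}\oplus\{\ell_i(S_i).T_i\}_{i\in I}$ with $\mathbb{G}_i\upharpoonright_{\mathtt{r}}T_i$; if $\mathbb{G}=\mathtt{p}\to\mathtt{q}:\{\ell_i(S_i).\mathbb{G}_i\}_{i\in I}$ with $\mathtt{r}\notin\{\mathtt{p},\mathtt{q}\}$ then $\mathbb{G}_i\upharpoonright_{\mathtt{r}}T$ for all $i$. Projection is functional; write $\mathbb{G}\upharpoonright\mathtt{r}$. $\mathbb{G}$ is balanced if for every subtree $\mathbb{G}'$ there is $k$ such that every $\mathtt{p}\in\mathrm{pt}(\mathbb{G}')$ occurs on every path from the root of $\mathbb{G}'$ of length at least $k$ or ending in $\mathtt{end}$. A local type environment $\Gamma$ is a finite map from participants to local type trees (compared by extensional equality); $\Gamma_1,\Gamma_2$ denotes union with disjoint domains. Environment transitions are the least relation with: $\mathtt{p}:\mathtt{q}\&\{\ell_i(S_i).T_i\}_{i\in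 I}\xrightarrow{\mathtt{p}:\mathtt{q}\&\ell_k(S_k)}\mathtt{p}:T_k$ and $\mathtt{p}:\mathtt{q}\oplus\{\ell_i(S_i).T_i\}_{i\in I}\xrightarrow{\mathtt{p}:\mathtt{q}\oplus\ell_k(S_k)}\mathtt{p}:T_k$ for $k\in I$; if $\Gamma\xrightarrow{\alpha}\Gamma'$ then $\Gamma,\mathtt{p}:T\xrightarrow{\alpha}\Gamma',\mathtt{p}:T$; if $\Gamma_1\xrightarrow{\mathtt{p}:\mathtt{q}\oplus\ell(S)}\Gamma_1'$, $\Gamma_2\xrightarrow{\mathtt{q}:\mathtt{p}\&\ell(S')}\Gamma_2'$ and $S\le S'$ then $\Gamma_1,\Gamma_2\xrightarrow{(\mathtt{p},\mathtt{q})\ell}\Gamma'_1,\Gamma'_2$. Write $\Gamma\xrightarrow{\alpha}$ if $\Gamma\xrightarrow{\alpha}\Gamma'$ for some $\Gamma'$, and $\Gamma\to\Gamma'$ if $\Gamma\xrightarrow{(\mathtt{p},\mathtt{q})\ell}\Gamma'$ for some $\mathtt{p},\mathtt{q},\ell$. Association: $\Gamma\sqsubseteq\mathbb{G}$ iff for all $\mathtt{p}\in\mathrm{pt}(\mathbb{G})$, $\mathtt{p}\in\mathrm{dom}(\Gamma)$ and $\Gamma(\mathtt{p})\le\mathbb{G}\upharpoonright\mathtt{p}$, and for all $\mathtt{p}\notin\mathrm{pt}(\mathbb{G})$, either $\mathtt{p}\notin\mathrm{dom}(\Gamma)$ or $\Gamma(\mathtt{p})=\mathtt{end}$. Safety: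 $\mathrm{safe}$ is the largest set of environments such that whenever $\Gamma\in\mathrm{safe}$: (i) if $\Gamma\xrightarrow{\mathtt{p}:\mathtt{q}\oplus\ell(S)}$ and $\Gamma\xrightarrow{\mathtt{q}:\mathtt{p}\&\ell'(S')}$ then $\Gamma\xrightarrow{(\mathtt{p},\mathtt{q})\ell}$; (ii) if $\Gamma\to\Gamma'$ then $\Gamma'\in\mathrm{safe}$. $\Gamma$ is safe iff $\Gamma\in\mathrm{safe}$. *)

(* Defs.v *)
From HB Require Import structures.
From mathcomp Require Import all_boot finmap.

Set Implicit Arguments.
Unset Strict Implicit.
Unset Printing Implicit Defensive.

Local Open Scope fset_scope.
Local Open Scope fmap_scope.

Definition participant : choiceType := nat.
Definition label : choiceType := nat.

Inductive vsort := sint | sbool | snat.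

Inductive subsort : vsort -> vsort -> Prop :=
| subsort_refl S : subsort S S
| subsort_nat_int : subsort snat sint.

(* A family {l_i ...}_{i in I} with I finite, nonempty and the l_i distinct,
   indexed by its own labels: a finite map with nonempty domain. It is not stored
   as a {fmap label -> V} with a nonemptiness proof because such a proof would
   mention V, which the positivity condition on the tree types below excludes;
   and [continuation] is a plain function so that trees can be defined by cofix. *)
Record branches (V : Type) := Branches {
  labels : {fset label};
  labels_neq0 : labels != fset0;
  continuation : labels -> V
}.

Definition fmap_of_branches (V : Type) (bs : branches V) : finMap label V :=
  [fmap l : labels bs => continuation l].
Coercion fmap_of_branches : branches >-> finMap.

CoInductive ltt :=
| lend
| lrecv (p : participant) (bs : branches (vsort * ltt))
| lsend (p : participant) (bs : branches (vsort * ltt)).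

CoInductive gtt :=
| gend
| gmsg (p q : participant) (bs : branches (vsort * gtt)).

CoInductive subtype : ltt -> ltt -> Prop :=
| subtype_end : subtype lend lend
| subtype_recv p (bs bs' : branches (vsort * ltt)) :
    (forall l S' T', bs'.[? l] = Some (S', T') ->
       exists S T, [/\ bs.[? l] = Some (S, T), subsort S' S & subtype T T']) ->
    subtype (lrecv p bs) (lrecv p bs')
| subtype_send p (bs bs' : branches (vsort * ltt)) :
    (forall l S T, bs.[? l] = Some (S, T) ->
       exists S' T', [/\ bs'.[? l] = Some (S', T'), subsort S S' & subtype T T']) ->
    subtype (lsend p bs) (lsend p bs').

(* [pt r G]: r belongs to pt(G). *)
Inductive pt (r : participant) : gtt -> Prop :=
| pt_sender q bs : pt r (gmsg r q bs)
| pt_receiver p bs : pt r (gmsg p r bs)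
| pt_branch p q (bs : branches (vsort * gtt)) l S G :
    bs.[? l] = Some (S, G) -> pt r G -> pt r (gmsg p q bs).

(* [proj r G T]: G projects onto r as T. *)
CoInductive proj (r : participant) (G : gtt) (T : ltt) : Prop := Proj {
  proj_notin : ~ pt r G -> T = lend;
  proj_recv : forall p (bs : branches (vsort * gtt)), G = gmsg p r bs ->
    exists bs' : branches (vsort * ltt),
      [/\ T = lrecv p bs', labels bs' = labels bs &
          forall l S Gl, bs.[? l] = Some (S, Gl) ->
            exists Tl, bs'.[? l] = Some (S, Tl) /\ proj r Gl Tl];
  proj_send : forall q (bs : branches (vsort * gtt)), G = gmsg r q bs ->
    exists bs' : branches (vsort * ltt),
      [/\ T = lsend q bs', labels bs' = labels bs &
          forall l S Gl, bs.[? l] = Some (S, Gl) ->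
            exists Tl, bs'.[? l] = Some (S, Tl) /\ proj r Gl Tl];
  proj_other : forall p q (bs : branches (vsort * gtt)), G = gmsg p q bs ->
    r <> p -> r <> q ->
    forall l S Gl, bs.[? l] = Some (S, Gl) -> proj r Gl T
}.

Definition projectable (G : gtt) : Prop :=
  forall r, pt r G -> exists T, proj r G T.

(* [gpath G s G']: a path from the root of G down to its subtree G'; s lists the
   (sender, receiver) pairs of the nodes it leaves, so its length is [size s]. *)
Inductive gpath : gtt -> seq (participant * participant) -> gtt -> Prop :=
| gpath_nil G : gpath G [::] G
| gpath_cons p q (bs : branches (vsort * gtt)) l S G s G' :
    bs.[? l] = Some (S, G) -> gpath G s G' ->
    gpath (gmsg p q bs) ((p, q) :: s) G'.

Definition occurs (p : participant) (s : seq (participant * participant)) : bool :=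
  has (fun c => (p == c.1) || (p == c.2)) s.

Definition subtree (G' G : gtt) : Prop := exists s, gpath G s G'.

Definition balanced (G : gtt) : Prop :=
  forall G', subtree G' G ->
    exists k : nat, forall p, pt p G' ->
      forall s G'', gpath G' s G'' -> leq k (size s) \/ G'' = gend ->
        occurs p s.

(* Finiteness, nonemptiness and distinctness of labels are built into [branches];
   the remaining syntactic condition is that nobody sends to itself. *)
Definition well_formed (G : gtt) : Prop :=
  forall p q bs, subtree (gmsg p q bs) G -> p <> q.

Definition env := {fmap participant -> ltt}.

Inductive action :=
| arecv (p q : participant) (l : label) (S : vsort)   (* p:q&l(S) *)
| asend (p q : participant) (l : label) (S : vsort)   (* p:q(+)l(S) *)
| acomm (p q : participant) (l : label).             (* (p,q)l *)

Inductive env_step : env -> action -> env -> Prop :=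
| es_recv p q (bs : branches (vsort * ltt)) l S T :
    bs.[? l] = Some (S, T) ->
    env_step [fmap].[p <- lrecv q bs] (arecv p q l S) [fmap].[p <- T]
| es_send p q (bs : branches (vsort * ltt)) l S T :
    bs.[? l] = Some (S, T) ->
    env_step [fmap].[p <- lsend q bs] (asend p q l S) [fmap].[p <- T]
| es_frame (Gamma Gamma' : env) a p T :
    p \notin domf Gamma -> p \notin domf Gamma' ->
    env_step Gamma a Gamma' ->
    env_step Gamma.[p <- T] a Gamma'.[p <- T]
| es_comm (Gamma1 Gamma1' Gamma2 Gamma2' : env) p q l S S' :
    [disjoint domf Gamma1 & domf Gamma2] ->
    [disjoint domf Gamma1' & domf Gamma2'] ->
    env_step Gamma1 (asend p q l S) Gamma1' ->
    env_step Gamma2 (arecv q p l S') Gamma2' ->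
    subsort S S' ->
    env_step (Gamma1 + Gamma2) (acomm p q l) (Gamma1' + Gamma2').

Definition can_step (Gamma : env) (a : action) : Prop :=
  exists Gamma', env_step Gamma a Gamma'.

Definition env_red (Gamma Gamma' : env) : Prop :=
  exists p q l, env_step Gamma (acomm p q l) Gamma'.

Definition associated (Gamma : env) (G : gtt) : Prop :=
  (forall p, pt p G ->
     exists T U, [/\ Gamma.[? p] = Some T, proj p G U & subtype T U]) /\
  (forall p, ~ pt p G -> p \notin domf Gamma \/ Gamma.[? p] = Some lend).

CoInductive safe (Gamma : env) : Prop := Safe {
  safe_comm : forall p q l l' S S',
    can_step Gamma (asend p q l S) -> can_step Gamma (arecv q p l' S') ->
    can_step Gamma (acomm p q l);
  safe_red : forall Gamma', env_red Gamma Gamma' -> safe Gamma'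
}.

(* Main.v *)
(** A communication (p,q)l enabled in an environment that refines the projections
    of [G] is matched by a transition of [G]: the projections onto p and q force
    every branch of [G] to reach a node p -> q before any other occurrence of p
    or q, and that node determines both projections, so they carry the same labels
    and sorts.  Firing the node in all branches yields a tree [G'] whose projections
    are the residuals, so "refines the projections of some [G]" is an invariant of
    reduction.  Reaching the node p -> q relies on balancedness, which is replaced
    by the following weaker property: in every subtree, a participant whose
    projection is not [lend] occurs on every branch after finitely many steps. *)

Require Import Defs.
From mathcomp Require Import all_boot finmap.
From Stdlib Require Import Classical.

Set Implicit Arguments.
Unset Strict Implicit.
Unset Printing Implicit Defensive.

Local Open Scope fset_scope.
Local Open Scope fmap_scope.

(** * Lookup in families of branches *)

Lemma branches_fnd (V : Type) (bs : branches V) (x : labels bs) :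
  bs.[? val x] = Some (continuation x).
Proof.
have xin : val x \in domf (fmap_of_branches bs) by case: x.
rewrite (in_fnd xin) /fmap_of_branches /= ffunE.
by congr (Some (continuation _)); apply/val_inj.
Qed.

Lemma branches_fnd_pair (A B : Type) (bs : branches (A * B)) (x : labels bs) :
  bs.[? val x] = Some ((continuation x).1, (continuation x).2).
Proof. by rewrite branches_fnd -surjective_pairing. Qed.

Lemma branches_fndP (V : Type) (bs : branches V) l v :
  bs.[? l] = Some v -> exists2 x : labels bs, val x = l & continuation x = v.
Proof.
move=> E; have lin : l \in labels bs.
  by rewrite -[labels bs]/(domf (fmap_of_branches bs)) -fndSome E.
by exists [` lin] => //; move: (branches_fnd [` lin]); rewrite E => -[].
Qed.

Lemma branches_inhabited (V : Type) (bs : branches V) : inhabited (labels bs).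
Proof. by case/fset0Pn: (labels_neq0 bs) => l lin; exists; exists l. Qed.

Lemma branches_labels_fnd (V W : Type) (bs : branches V) (bs' : branches W) l v :
  labels bs = labels bs' -> bs.[? l] = Some v -> exists w, bs'.[? l] = Some w.
Proof.
move=> E Ev; have [x <- _] := branches_fndP Ev.
have xin : val x \in labels bs' by rewrite -E fsvalP.
by exists (continuation [` xin]); rewrite -branches_fnd.
Qed.

Lemma subsort_trans S1 S2 S3 : subsort S1 S2 -> subsort S2 S3 -> subsort S1 S3.
Proof. by case=> // H; inversion H; constructor. Qed.

(** Labels and sorts stay as in [bs], so the two participants of the node keep the shape of their
    projections. *)
Definition replace_conts (bs : branches (vsort * gtt)) (c : labels bs -> gtt) :
    branches (vsort * gtt) :=
  Branches (labels_neq0 bs) (fun x => ((continuation x).1, c x)).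

Lemma replace_conts_fnd bs (c : labels bs -> gtt) l S G' :
  (replace_conts c).[? l] = Some (S, G') ->
  exists x, [/\ bs.[? l] = Some (S, (continuation x).2), val x = l & c x = G'].
Proof.
move=> E; have [x <- [<- <-]] := branches_fndP E; exists x; split=> //.
exact: (branches_fnd_pair (bs := bs)).
Qed.

(** * Environment transitions as lookups and updates *)

Definition env_step_spec (Gamma : env) (a : action) (Gamma' : env) : Prop :=
  match a with
  | asend p q l S0 => exists (bs : branches (vsort * ltt)) T,
      [/\ Gamma.[? p] = Some (lsend q bs), bs.[? l] = Some (S0, T)
        & Gamma' = Gamma.[p <- T]]
  | arecv p q l S0 => exists (bs : branches (vsort * ltt)) T,
      [/\ Gamma.[? p] = Some (lrecv q bs), bs.[? l] = Some (S0, T)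
        & Gamma' = Gamma.[p <- T]]
  | acomm p q l => exists (bs bs' : branches (vsort * ltt)) S T S' T',
      [/\ Gamma.[? p] = Some (lsend q bs) /\ bs.[? l] = Some (S, T),
          Gamma.[? q] = Some (lrecv p bs') /\ bs'.[? l] = Some (S', T'),
          subsort S S'
        & Gamma' = Gamma.[p <- T].[q <- T']]
  end.

Lemma fnd_domf (Gamma : env) p T : Gamma.[? p] = Some T -> p \in domf Gamma.
Proof. by move=> E; rewrite -fndSome E. Qed.

Lemma fnd_frame (Gamma : env) p r T U : r \notin domf Gamma ->
  Gamma.[? p] = Some T -> (p == r) = false /\ Gamma.[r <- U].[? p] = Some T.
Proof.
move=> rN E; have pr : (p == r) = false.
  by apply: contraNF rN => /eqP <-; apply: fnd_domf E.
by rewrite fnd_set pr.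
Qed.

Lemma env_step_inv Gamma a Gamma' :
  env_step Gamma a Gamma' -> env_step_spec Gamma a Gamma'.
Proof.
elim=> {Gamma a Gamma'}.
- move=> p q bs l S T E; exists bs, T; split=> //; first by rewrite fnd_set eqxx.
  by apply/fmapP=> r; rewrite !fnd_set; case: eqP.
- move=> p q bs l S T E; exists bs, T; split=> //; first by rewrite fnd_set eqxx.
  by apply/fmapP=> r; rewrite !fnd_set; case: eqP.
- move=> Gamma Gamma' a r U rN _ _; case: a => [p q l S|p q l S|p q l] /=.
  + case=> bs [T [/(fnd_frame U rN)[pr E] El ->]]; exists bs, T; split=> //.
    by rewrite setfC eq_sym pr.
  + case=> bs [T [/(fnd_frame U rN)[pr E] El ->]]; exists bs, T; split=> //.
    by rewrite setfC eq_sym pr.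
  + case=> bs [bs' [S [T [S' [T']]]]].
    case=> -[/(fnd_frame U rN)[pr E] El] [/(fnd_frame U rN)[qr E'] El'] sub ->.
    exists bs, bs', S, T, S', T'; split=> //.
    by rewrite setfC eq_sym qr; congr (_.[_ <- _]); rewrite setfC eq_sym pr.
- move=> G1 G1' G2 G2' p q l S S' /fdisjointP dis _ _ [bs [T [E El ->]]].
  move=> _ [bs' [T' [E' El' ->]]] sub.
  exists bs, bs', S, T, S', T'; split=> //.
  + by split=> //; rewrite fnd_cat (negPf (dis _ (fnd_domf E))).
  + by split=> //; rewrite fnd_cat (fnd_domf E').
  + apply/fmapP=> r; rewrite !(fnd_set, fnd_cat) dom_setf !inE.
    case: (r =P q) => //= _; case: (r =P p) => [->|//].
    by rewrite (negPf (dis _ (fnd_domf E))).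
Qed.

(** The rule [es_frame] adds one participant at a time, hence an induction on the number [n] of
    participants of [Gamma] other than [p]. *)
Lemma env_step_frame (Gamma : env) p T T' a :
  Gamma.[? p] = Some T -> env_step [fmap].[p <- T] a [fmap].[p <- T'] ->
  env_step Gamma a Gamma.[p <- T'].
Proof.
move=> + st; move Dn: #|` domf Gamma `\ p| => n.
elim: n Gamma Dn => [|n IH] Gamma Dn E.
  have -> : Gamma = [fmap].[p <- T].
    apply/fmapP=> r; rewrite fnd_set; case: eqP => [-> //|/eqP rp].
    rewrite fnd_fmap0 not_fnd //; apply/negP=> rin.
    by have := cardfs0_eq Dn; move/fsetP/(_ r); rewrite !inE rp rin.
  suff -> : [fmap].[p <- T].[p <- T'] = [fmap].[p <- T'] by [].
  by apply/fmapP=> r; rewrite !fnd_set; case: eqP.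
have /fset0Pn[r] : domf Gamma `\ p != fset0 by rewrite -cardfs_eq0 Dn.
rewrite !inE => /andP[rp rin].
have rN U : r \notin domf Gamma.[~ r].[p <- U].
  by rewrite dom_setf domf_rem !inE (negPf rp) eqxx.
have pr : p == r = false by rewrite eq_sym (negPf rp).
have -> : Gamma = Gamma.[~ r].[r <- Gamma.[rin]].
  apply/fmapP=> s; rewrite fnd_set fnd_rem1.
  by case: eqP => //= ->; rewrite (in_fnd rin).
rewrite setfC pr; apply: es_frame => //.
  by rewrite domf_rem !inE eqxx.
apply: IH; last by rewrite fnd_rem1 pr E.
move: Dn; rewrite (cardfsD1 r) !inE rp rin => -[<-]; rewrite add0n.
by rewrite domf_rem fsetDDl fsetUC -fsetDDl.
Qed.

(** [Gamma] is split into the singleton at [p] and the rest; the receiver's transition is then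
    framed inside the rest. *)
Lemma env_comm_intro (Gamma : env) p q (bs bs' : branches (vsort * ltt))
    l S T S' T' :
  Gamma.[? p] = Some (lsend q bs) -> bs.[? l] = Some (S, T) ->
  Gamma.[? q] = Some (lrecv p bs') -> bs'.[? l] = Some (S', T') ->
  subsort S S' -> can_step Gamma (acomm p q l).
Proof.
move=> E El E' El' sub.
have qp : q == p = false.
  by apply/eqP=> qp; move: E'; rewrite qp E.
have -> : Gamma = [fmap].[p <- lsend q bs] + Gamma.[~ p].
  apply/fmapP=> r; rewrite fnd_cat fnd_set fnd_rem1 domf_rem !inE fnd_fmap0.
  case: (r =P p) => [->|_] //=.
  by case: fndP.
exists ([fmap].[p <- T] + Gamma.[~ p].[q <- T']).
have dis U V : [disjoint domf ([fmap].[p <- U] : env) & domf Gamma.[~ p].[q <- V]].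
  apply/fdisjointP=> r; rewrite !dom_setf domf_rem !inE orbF => /eqP ->.
  by rewrite eq_sym qp eqxx.
apply: es_comm (sub) => //.
- apply/fdisjointP=> r; rewrite !dom_setf domf_rem !inE orbF => /eqP ->.
  by rewrite eqxx.
- exact: es_send El.
- apply: (@env_step_frame _ q (lrecv p bs')); last exact: es_recv El'.
  by rewrite fnd_rem1 qp.
Qed.

(** * Global transitions and liveness *)

(* Being inductive, a derivation reaches a node p -> q on every branch. *)
Inductive gstep (p q : participant) (l : label) : gtt -> gtt -> Prop :=
| gstep_here (bs : branches (vsort * gtt)) S G :
    bs.[? l] = Some (S, G) -> gstep p q l (gmsg p q bs) G
| gstep_under r s (bs : branches (vsort * gtt)) (c : labels bs -> gtt) :
    p <> r -> p <> s -> q <> r -> q <> s ->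
    (forall x, gstep p q l (continuation x).2 (c x)) ->
    gstep p q l (gmsg r s bs) (gmsg r s (replace_conts c)).

Inductive inevitable (r : participant) : gtt -> Prop :=
| inevitable_sender q bs : inevitable r (gmsg r q bs)
| inevitable_receiver p bs : inevitable r (gmsg p r bs)
| inevitable_under p q (bs : branches (vsort * gtt)) :
    (forall x : labels bs, inevitable r (continuation x).2) ->
    inevitable r (gmsg p q bs).

(* Unlike balancedness, preserved by [gstep] without assuming projectability. *)
CoInductive live (G : gtt) : Prop := Live {
  live_root : forall r T, proj r G T -> T <> lend -> inevitable r G;
  live_branch : forall p q (bs : branches (vsort * gtt)), G = gmsg p q bs ->
    forall x : labels bs, live (continuation x).2
}.

Lemma occurs_inevitable r k G :
  (forall s G', gpath G s G' -> leq k (size s) \/ G' = gend -> occurs r s) ->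
  inevitable r G.
Proof.
elim: k G => [|k IH] G H.
  (* With bound 0 the empty path already qualifies, and nobody occurs on it. *)
  by have := H _ _ (gpath_nil G) (or_introl isT).
case: G H => [|p q bs] H.
  by have := H _ _ (gpath_nil gend) (or_intror erefl).
case: (r =P p) => [->|rp]; first exact: inevitable_sender.
case: (r =P q) => [->|rq]; first exact: inevitable_receiver.
apply: inevitable_under => x; apply: IH => s G' path end_s.
have := H _ _ (gpath_cons p q (branches_fnd_pair x) path); rewrite /occurs /=.
by move/eqP/negPf: rp => ->; move/eqP/negPf: rq => -> /=; apply.
Qed.

(** A projection other than [lend] puts [r] in pt(G), so the bound given by balancedness applies to
    [r]. *)
Lemma balanced_live G : balanced G -> live G.
Proof.
move: G; cofix CIH => G bal; split.
- move=> r T pr Tend; have ptr : pt r G.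
    by apply: NNPP => /(proj_notin pr).
  have [|k /(_ r ptr)] := bal G; first by exists [::]; apply: gpath_nil.
  exact: occurs_inevitable.
- move=> p q bs GE x; apply: CIH => G' [s path]; apply: bal.
  exists ((p, q) :: s); rewrite GE.
  exact: gpath_cons (branches_fnd_pair x) path.
Qed.

(** * Projection and its behaviour under global transitions *)

Lemma proj_cont r p q (bs : branches (vsort * gtt)) T :
  proj r (gmsg p q bs) T -> r <> p -> r <> q ->
  forall x : labels bs, proj r (continuation x).2 T.
Proof.
move=> pr rp rq x; exact: (proj_other pr erefl rp rq (branches_fnd_pair x)).
Qed.

Lemma proj_under r p q (bs : branches (vsort * gtt)) (T : ltt) :
  r <> p -> r <> q -> (forall x : labels bs, proj r (continuation x).2 T) ->
  proj r (gmsg p q bs) T.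
Proof.
move=> rp rq prc; split.
- move=> npt; have [x] := branches_inhabited bs.
  apply: (proj_notin (prc x)) => ptx; apply: npt.
  exact: pt_branch (branches_fnd_pair x) ptx.
- by move=> ? ? [_ /esym].
- by move=> ? ? [/esym].
- move=> ? ? ? [_ _ <-] _ _ l S Gl El; have [x _ Ex] := branches_fndP El.
  by move: (prc x); rewrite Ex.
Qed.

Lemma proj_end r G : ~ pt r G -> proj r G lend.
Proof.
move: G; cofix CIH => G npt; split.
- by move=> _.
- by move=> p bs GE; case: npt; rewrite GE; apply: pt_receiver.
- by move=> q bs GE; case: npt; rewrite GE; apply: pt_sender.
- move=> p q bs GE _ _ l S Gl El; apply: CIH => ptl; apply: npt.
  by rewrite GE; apply: pt_branch El ptl.
Qed.

Lemma gstep_live p q l G G' : gstep p q l G G' -> live G -> live G'.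
Proof.
(* [inevitable] is inductive, so the root clause is settled first by induction on the transition;
   only the clause on branches is left to coinduction. *)
have root_live H H' : gstep p q l H H' -> live H ->
    forall r T, proj r H' T -> T <> lend -> inevitable r H'.
  elim=> {H H'} [bs S G0 El lG|a b bs c _ _ _ _ _ IH lG] r T pr Tend.
    have [x _ Ex] := branches_fndP El.
    by have := live_branch lG erefl x; rewrite Ex => /live_root; apply; eassumption.
  case: (r =P a) => [->|ra]; first exact: inevitable_sender.
  case: (r =P b) => [->|rb]; first exact: inevitable_receiver.
  apply: inevitable_under => x.
  exact: IH x (live_branch lG erefl x) r T (proj_cont pr ra rb x) Tend.
move: G G'; cofix CIH => G G' st lG; split; first exact: root_live st lG.
case: st lG => {G G'} [bs S G0 El lG|a b bs c _ _ _ _ st lG] a' b' bs0.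
  have [x _ Ex] := branches_fndP El.
  have := live_branch lG erefl x; rewrite Ex => lG0 GE; exact (live_branch lG0 GE).
by case=> _ _ <- x; apply: CIH (st x) (live_branch lG erefl x).
Qed.

(** Induction on the inevitability of [p]. A node sent by [p] must go to [q], and both projections
    copy its labels and sorts. Any other node involving [p] or [q] contradicts one of the two
    projections, so the remaining nodes are passed through. *)
Lemma gstep_exists p q l G bp bq S U :
  inevitable p G -> proj p G (lsend q bp) -> proj q G (lrecv p bq) ->
  bp.[? l] = Some (S, U) ->
  (exists V, bq.[? l] = Some (S, V)) /\ exists G', gstep p q l G G'.
Proof.
move=> + + + Ep.
have here b bs : proj p (gmsg p b bs) (lsend q bp) ->
    proj q (gmsg p b bs) (lrecv p bq) ->
    (exists V, bq.[? l] = Some (S, V)) /\ exists G', gstep p q l (gmsg p b bs) G'.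
  move=> pp pq; have [bp' [[Eb Ebp] labp fnp]] := proj_send pp erefl.
  subst b; have [bq' [[Ebq] _ fnq]] := proj_recv pq erefl.
  subst bp' bq'; have [[S0 G0] E0] := branches_labels_fnd labp Ep.
  have [Tp []] := fnp _ _ _ E0; rewrite Ep => -[ES _] _.
  rewrite -ES in E0; split; last by exists G0; apply: gstep_here E0.
  by have [Tq [EV _]] := fnq _ _ _ E0; exists Tq.
elim=> {G} [b bs|a bs|a b bs _ IH] pp pq; first exact: here.
- by have [? []] := proj_recv pp erefl.
- case: (p =P a) pp pq => [<-|pa] pp pq; first exact: here.
  case: (p =P b) pp => [<-|pb] pp; first by have [? []] := proj_recv pp erefl.
  case: (q =P a) pq => [<-|qa] pq; first by have [? []] := proj_send pq erefl.
  case: (q =P b) pq => [<-|qb] pq; first by have [? [[]]] := proj_recv pq erefl.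
  have {}IH x := IH x (proj_cont pp pa pb x) (proj_cont pq qa qb x).
  split; first by have [x] := branches_inhabited bs; case: (IH x).
  (* Finite choice over the labels collects the residuals of all branches. *)
  have [c st] := fin_all_exists (fun x => (IH x).2).
  by exists (gmsg a b (replace_conts c)); apply: gstep_under.
Qed.

Lemma gstep_proj_sender p q l G G' bp S U :
  gstep p q l G G' -> proj p G (lsend q bp) -> bp.[? l] = Some (S, U) ->
  proj p G' U.
Proof.
move=> + + Ep; elim=> {G G'} [bs S0 G0 E0|a b bs c pa pb _ _ _ IH] pp.
  have [_ [[<-] _ /(_ _ _ _ E0)[T []]]] := proj_send pp erefl.
  by rewrite Ep => -[_ ->].
by apply: (proj_under pa pb) => x; exact: IH (proj_cont pp pa pb x).
Qed.

Lemma gstep_proj_receiver p q l G G' bq S U :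
  gstep p q l G G' -> proj q G (lrecv p bq) -> bq.[? l] = Some (S, U) ->
  proj q G' U.
Proof.
move=> + + Eq; elim=> {G G'} [bs S0 G0 E0|a b bs c _ _ qa qb _ IH] pq.
  have [_ [[<-] _ /(_ _ _ _ E0)[T []]]] := proj_recv pq erefl.
  by rewrite Eq => -[_ ->].
by apply: (proj_under qa qb) => x; exact: IH (proj_cont pq qa qb x).
Qed.

(** At the fired node [r] is a bystander, so every branch projects to the same [T]; the nodes above
    keep their labels and sorts. *)
Lemma gstep_proj_other p q l r G G' T :
  gstep p q l G G' -> r <> p -> r <> q -> proj r G T -> proj r G' T.
Proof.
move=> st rp rq.
elim: st T => {G G'} [bs S G0 E0|a b bs c _ _ _ _ _ IH] T pr.
  exact: (proj_other pr erefl rp rq E0).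
have step_conts (bT : branches (vsort * ltt)) :
    (forall l S Gl, bs.[? l] = Some (S, Gl) ->
       exists Tl, bT.[? l] = Some (S, Tl) /\ proj r Gl Tl) ->
    forall l S Gl, (replace_conts c).[? l] = Some (S, Gl) ->
       exists Tl, bT.[? l] = Some (S, Tl) /\ proj r Gl Tl.
  move=> fnT l' S Gl /replace_conts_fnd[x [E _ <-]].
  by have [Tl [ETl prl]] := fnT _ _ _ E; exists Tl; split; [|exact: IH].
case: (r =P a) => [ra|ra]; last case: (r =P b) => [rb|rb].
- subst a; have [bT [TE lT fnT]] := proj_send pr erefl; split.
  + by case; apply: pt_sender.
  (* If [r] were both sender and receiver, [T] would be both a send and a receive. *)
  + move=> p' bs' [_ br _]; subst b.
    by have [? []] := proj_recv pr erefl; rewrite TE.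
  + by move=> q' bs' [<- <-]; exists bT; split; [| |exact: step_conts].
  + by move=> p' q' bs' [<-].
- subst b; have [bT [TE lT fnT]] := proj_recv pr erefl; split.
  + by case; apply: pt_receiver.
  + by move=> p' bs' [<- <-]; exists bT; split; [| |exact: step_conts].
  + by move=> q' bs' [/esym].
  + by move=> p' q' bs' [_ <-].
- by apply: (proj_under ra rb) => x; exact: IH (proj_cont pr ra rb x).
Qed.

(** * The invariant and safety *)

(** Quantifying over the domain of [Gamma] avoids tracking how pt(G) shrinks along global
    transitions. *)
Definition realises (Gamma : env) (G : gtt) : Prop :=
  forall p T, Gamma.[? p] = Some T -> exists2 U, proj p G U & subtype T U.

Lemma associated_realises Gamma G : associated Gamma G -> realises Gamma G.
Proof.
move=> [assoc_in assoc_out] p T E.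
have [/assoc_in[T' [U []]]|npt] := classic (pt p G).
  by rewrite E => -[<-] pr sub; exists U.
have [|] := assoc_out p npt; first by rewrite (fnd_domf E).
rewrite E => -[->]; exists lend; first exact: proj_end.
exact: subtype_end.
Qed.

(** Serves both clauses of safety: the receiver's branch at [l] enables the communication, and [G']
    with its projections restores the invariant. *)
Lemma realises_pair Gamma G p q (bs bs' : branches (vsort * ltt)) l S T :
  live G -> realises Gamma G ->
  Gamma.[? p] = Some (lsend q bs) -> bs.[? l] = Some (S, T) ->
  Gamma.[? q] = Some (lrecv p bs') ->
  exists G' U V S' T',
    [/\ gstep p q l G G', proj p G' U /\ subtype T U, bs'.[? l] = Some (S', T'),
        subsort S S' & proj q G' V /\ subtype T' V].
Proof.
move=> lG re E El E'; have [W pp sub] := re _ _ E; have [X pq sub'] := re _ _ E'.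
inversion sub as [| |q0 b0 bp subp]; subst.
inversion sub' as [|p0 b0 bq subq|]; subst.
have [SU [U [Ep sS sT]]] := subp _ _ _ El.
(* The projection onto [p] is a send, hence not [lend]. *)
have inev : inevitable p G by apply: (live_root lG pp).
have [[V Eq] [G' st]] := gstep_exists inev pp pq Ep.
(* Both projections carry the sort [SU] at [l], which links the two subtypings: [S] is below [SU]
   and [SU] below [S']. *)
have [S' [T' [El' sS' sT']]] := subq _ _ _ Eq.
exists G', U, V, S', T'; split.
- exact: st.
- by split; [exact: gstep_proj_sender st pp Ep|].
- exact: El'.
- exact: subsort_trans sS sS'.
- by split; [exact: gstep_proj_receiver st pq Eq|].
Qed.

Lemma realises_red Gamma Gamma' G :
  live G -> realises Gamma G -> env_red Gamma Gamma' ->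
  exists G', live G' /\ realises Gamma' G'.
Proof.
move=> lG re [p [q [l /env_step_inv]]].
case=> bs [bs' [S [T [S' [T' [[E El] [E' El'] _ ->]]]]]].
have [G' [U [V [S1 [T1 [st [pp sp]]]]]]] := realises_pair lG re E El E'.
(* Both lookups of [l] in [bs'] agree, so [T1] is the receiver's actual residual [T']. *)
rewrite El' => -[_ <-] _ [pq sq]; exists G'; split; first exact: gstep_live st lG.
move=> r W; rewrite !fnd_set; case: (r =P q) => [->|rq].
  by case=> <-; exists V.
case: (r =P p) => [->|rp]; first by case=> <-; exists U.
move=> /re[X pr sX]; exists X; last exact: sX.
exact: gstep_proj_other st rp rq pr.
Qed.

Lemma realises_safe Gamma G : live G -> realises Gamma G -> safe Gamma.
Proof.
move: Gamma G; cofix CIH => Gamma G lG re; split.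
- move=> p q l l' S S' [_ /env_step_inv[bs [T [E El _]]]].
  move=> [_ /env_step_inv[bs' [_ [E' _ _]]]].
  have [_ [_ [_ [S1 [T1 [_ _ E1 sub _]]]]]] := realises_pair lG re E El E'.
  exact: env_comm_intro E El E' E1 sub.
- by move=> Gamma' /(realises_red lG re)[G' [lG' re']]; apply: CIH lG' re'.
Qed.

Theorem mainTheorem3 (Gamma : env) (G : gtt)
    (Gbal : balanced G) (Gwf : well_formed G) (Gproj : projectable G) :
  associated Gamma G -> safe Gamma.
Proof.
by move=> /associated_realises; apply: realises_safe (balanced_live Gbal).
Qed.
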